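(* Fix a mesh size $h>0$. For real parameters $\alpha_U\neq0$, $\omega_U$, $\sigma\ne0$ and $\boldsymbol\theta\in T^{\rm high}$ let $$\widetilde{\mathcal S}_U(\alpha_U,\omega_U,\sigma,\boldsymbol\theta)=I-\omega_U\,\widetilde M_U(\boldsymbol\theta)^{-1}\,\widetilde{\mathcal L}(\boldsymbol\theta)$$ be the $3\times3$ error-propagation symbol of the mass-based $\sigma$-Uzawa relaxation ($Q$-$\sigma$-Uzawa). Then the optimal smoothing factor over all possible parameters is $$\mu_{{\rm opt},U}=\min_{(\alpha_U,\omega_U,\sigma)}\ \max_{\boldsymbol\theta\in T^{\rm high}}\ \big|\lambda\big(\widetilde{\mathcal S}_U(\alpha_U,\omega_U,\sigma,\boldsymbol\theta)\big)\big|=\sqrt{1-\frac{9m_{\rm opt}}{16}}=\sqrt{\frac13},$$ where $\lambda(\cdot)$ ranges over all eigenvalues of the matrix and $m_{\rm opt}=\frac{32}{27}$. The minimum is attained, with $m_2:=\frac{4\alpha_U\sigma}{(1+\sigma)^2}=m_{\rm opt}=\frac{32}{27}$, provided that $$\frac{1}{3\mu_{{\rm opt},U}}\le\omega_U\le\frac{2}{3(1-\mu_{{\rm opt},U})},\qquad \alpha_U=\frac{8\omega_U^2}{3(3\omega_U-1)},\qquad \sigma=\frac{1}{3\omega_U-1}.$$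
   Context: Setting: local Fourier analysis of multigrid relaxation for the 2D Stokes equations discretized by the staggered (MAC) finite-difference scheme on a uniform mesh of size $h$. Operators are represented by their symbols (complex matrices depending on $\boldsymbol\theta=(\theta_1,\theta_2)$). High frequencies: $T^{\rm high}=[-\frac{\pi}{2},\frac{3\pi}{2})^2\setminus[-\frac{\pi}{2},\frac{\pi}{2})^2$. $m(\boldsymbol\theta)=\sin^2(\theta_1/2)+\sin^2(\theta_2/2)$, so that the five-point scalar (negative) Laplacian has symbol $4m(\boldsymbol\theta)/h^2$. The bilinear finite element mass stencil $Q$ has symbol $\widetilde Q=\frac{h^2}{9}(2+\cos\theta_1)(2+\cos\theta_2)$, and $m_s(\boldsymbol\theta)=\left(\frac19(2+\cos\theta_1)(2+\cos\theta_2)\right)^{-1}$, i.e. $\widetilde Q = h^2/m_s$. Symbol of the discrete Stokes operator: $$\widetilde{\mathcal L}(\boldsymbol\theta)=\frac1{h^2}\begin{pmatrix} 4m & 0 & i2h\sin\frac{\theta_1}{2} \\ 0 & 4m & i2h\sin\frac{\theta_2}{2} \\ -i2h\sin\frac{\theta_1}{2} & -i2h\sin\frac{\theta_2}{2} & 0 \end{pmatrix}.$$ Symbol of the Uzawa operator $M_U=\begin{pmatrix} \alpha_U C & 0 \\ B & -\sigma^{-1}I \end{pmatrix}$ with $C^{-1}={\rm diag}(Q,Q)$, where $B$ is the negative of the discrete divergence operator: $$\widetilde M_U(\boldsymbol\theta)=\frac1{h^2}\begin{pmatrix} \alpha_Um_s & 0 & 0 \\ 0 & \alpha_Um_s & 0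 \\ -i2h\sin\frac{\theta_1}{2} & -i2h\sin\frac{\theta_2}{2} & -\sigma^{-1}h^2 \end{pmatrix}.$$ *)

(* Defs.v *)
From HB Require Import structures.
From mathcomp Require Import all_boot all_order all_algebra.
From mathcomp Require Import all_classical all_reals all_analysis.
From mathcomp Require Import complex.

Set Implicit Arguments.
Unset Strict Implicit.
Unset Printing Implicit Defensive.

Import Order.TTheory GRing.Theory Num.Theory.
Local Open Scope classical_set_scope.
Local Open Scope complex_scope.
Local Open Scope ring_scope.

Definition is_maximum (R : realType) (A : set R) (x : R) : Prop :=
  A x /\ ubound A x.

Definition is_minimum (R : realType) (A : set R) (x : R) : Prop :=
  A x /\ lbound A x.

Definition mx3 (T : nzRingType) (rows : seq (seq T)) : 'M[T]_3 :=
  \matrix_(i < 3, j < 3) nth 0 (nth [::] rows i) j.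

Definition Thigh (R : realType) : set (R * R) :=
  (`[- (pi / 2), 3 * pi / 2[ `*` `[- (pi / 2), 3 * pi / 2[)
    `\` (`[- (pi / 2), pi / 2[ `*` `[- (pi / 2), pi / 2[).

(* The five-point negative Laplacian on a mesh of size h has symbol
   4 m(theta) / h^2. *)
Definition m_sym (R : realType) (theta : R * R) : R :=
  sin (theta.1 / 2) ^+ 2 + sin (theta.2 / 2) ^+ 2.

(* The bilinear finite element mass stencil Q has symbol h^2 / m_s(theta). *)
Definition ms_sym (R : realType) (theta : R * R) : R :=
  (9^-1 * (2 + cos theta.1) * (2 + cos theta.2))^-1.

Definition stokes_symbol (R : realType) (h : R) (theta : R * R) : 'M[R[i]]_3 :=
  let d1 := 'i%C * (2 * h * sin (theta.1 / 2))%:C in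
  let d2 := 'i%C * (2 * h * sin (theta.2 / 2))%:C in
  let a := (4 * m_sym theta)%:C in
  ((h ^+ 2)^-1)%:C *:
    mx3 [:: [:: a;    0;    d1];
            [:: 0;    a;    d2];
            [:: - d1; - d2; 0 ]].

(* Symbol of [alpha C, 0; B, - sigma^-1 I] with C^-1 = diag(Q, Q) and B the
   negative discrete divergence. *)
Definition uzawa_symbol (R : realType) (h alpha sigma : R) (theta : R * R)
    : 'M[R[i]]_3 :=
  let d1 := 'i%C * (2 * h * sin (theta.1 / 2))%:C in
  let d2 := 'i%C * (2 * h * sin (theta.2 / 2))%:C in
  let c := (alpha * ms_sym theta)%:C in
  ((h ^+ 2)^-1)%:C *:
    mx3 [:: [:: c;    0;    0];
            [:: 0;    c;    0];
            [:: - d1; - d2; (- (sigma^-1 * h ^+ 2))%:C]].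

(* [uzawa_symbol] is invertible whenever h, alpha and sigma are nonzero;
   [invmx] is the identity on singular matrices. *)
Definition uzawa_error_symbol (R : realType) (h alpha omega sigma : R)
    (theta : R * R) : 'M[R[i]]_3 :=
  1%:M - omega%:C *:
    (invmx (uzawa_symbol h alpha sigma theta) *m stokes_symbol h theta).

Definition high_freq_moduli (R : realType) (h alpha omega sigma : R) : set R :=
  [set r | exists theta : R * R, exists lambda : R[i],
     [/\ Thigh theta,
         eigenvalue (uzawa_error_symbol h alpha omega sigma theta) lambda
       & `|lambda| = r%:C]].

Definition smoothing_factor (R : realType) (h alpha omega sigma : R) : R :=
  sup (high_freq_moduli h alpha omega sigma).

Definition smoothing_factors (R : realType) (h : R) : set R :=
  [set mu | exists alpha omega sigma : R,
     [/\ alpha != 0, sigma != 0 & mu = smoothing_factor h alpha omega sigma]].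

Definition mu_opt (R : realType) (h : R) : R := inf (smoothing_factors h).

Definition m_opt (R : realType) : R := 32 / 27.

(* Main.v *)
(* Write t = 4 m / (alpha m_s).  The error symbol has the eigenvalue
   1 - t omega and the two roots of the real quadratic
     z^2 - (2 - t A) z + (1 - t D),
   A = omega (1 + sigma), D = omega (1 + sigma) - sigma omega^2.  On the high
   frequencies m / m_s fills the interval [2/9, 4/9], so t ranges over an
   interval whose right end is twice its left end, and the spectral radius,
   continuous in t, attains its maximum r.  At t and 2 t the product of the two
   roots gives |1 - t D| <= r^2 and |1 - 2 t D| <= r^2, hence
   1 = 2 (1 - t D) - (1 - 2 t D) <= 3 r^2.  Equality forces t D = 2/3; the stated
   parameters achieve it with t A = 1, and the range of omega is exactly what
   the remaining eigenvalue 1 - t omega allows. *)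

Require Import Defs.
From HB Require Import structures.
From mathcomp Require Import all_boot all_order all_algebra.
From mathcomp Require Import all_classical all_reals all_analysis.
From mathcomp Require Import complex ring lra.

Import Order.TTheory GRing.Theory Num.Theory.
Import numFieldNormedType.Exports.
Local Open Scope ring_scope.

(** * Determinant criteria for eigenvalues *)

Lemma det_mx3 (T : comNzRingType) (a b c d e f g k l : T) :
  \det (mx3 [:: [:: a; b; c]; [:: d; e; f]; [:: g; k; l]]) =
  a * (e * l - f * k) - b * (d * l - f * g) + c * (d * k - e * g).
Proof.
rewrite (expand_det_row _ ord0) !big_ord_recl big_ord0 /cofactor.
rewrite !(expand_det_row _ ord0) !big_ord_recl !big_ord0 /cofactor !det_mx11.
rewrite !mxE /=; ring.
Qed.

Lemma eigenvalue_det (F : fieldType) (n : nat) (A : 'M[F]_n) (z : F) :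
  eigenvalue A z = (\det (z%:M - A) == 0).
Proof.
rewrite /eigenvalue /eigenspace kermx_eq0 row_free_unit unitmxE unitfE negbK.
by rewrite -opprB -scaleN1r detZ mulf_eq0 expf_eq0 oppr_eq0 oner_eq0 andbF.
Qed.

(** Multiplying the characteristic matrix by the invertible [M] does not change whether its
    determinant vanishes, so [M] never has to be inverted explicitly. *)
Lemma eigenvalue_preconditioned (F : fieldType) (n : nat) (M L : 'M[F]_n) (w z : F) :
  M \in unitmx ->
  eigenvalue (1%:M - w *: (invmx M *m L)) z =
  (\det ((z - 1) *: M + w *: L) == 0).
Proof.
move=> uM; rewrite eigenvalue_det.
have -> : (z - 1) *: M + w *: L = M *m (z%:M - (1%:M - w *: (invmx M *m L))).
  rewrite opprB addrCA -raddfB /= mulmxDr -scalemxAr mulKVmx // addrC.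
  by rewrite mul_mx_scalar.
by rewrite det_mulmx mulf_eq0; move: uM; rewrite unitmxE unitfE => /negbTE ->.
Qed.

(** A quarter of the symbol of [Q] times the negative Laplacian: the only quantity through which the
    eigenvalues depend on the frequency. *)
Definition laplace_ratio {R : realType} (theta : R * R) : R :=
  m_sym theta / ms_sym theta.

(** * Characteristic polynomial of the error symbol *)

Section Symbol.
Variable R : realType.

Lemma ms_sym_gt0 (theta : R * R) : 0 < ms_sym theta.
Proof.
have := @cos_geN1 R theta.1; have := @cos_geN1 R theta.2 => c2 c1.
by rewrite invr_gt0 !mulr_gt0 ?invr_gt0 //; lra.
Qed.

Lemma eigenvalue_uzawa (h alpha omega sigma : R) (theta : R * R) (z : R[i]) :
  h != 0 -> alpha != 0 -> sigma != 0 ->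
  let t := 4 * laplace_ratio theta / alpha in
  eigenvalue (uzawa_error_symbol h alpha omega sigma theta) z =
  (z == (1 - t * omega)%:C%C) ||
  (z ^+ 2 - (2 - t * (omega * (1 + sigma)))%:C%C * z
     + (1 - t * (omega * (1 + sigma) - sigma * omega ^+ 2))%:C%C == 0).
Proof.
move=> h0 a0 s0 t.
have ms0 : ms_sym theta != 0 by rewrite gt_eqF ?ms_sym_gt0.
have C0 (x : R) : x != 0 -> x%:C%C != 0.
  by move=> x0; rewrite eq_complex /= negb_and x0.
set ms := ms_sym theta in ms0; set m := m_sym theta.
have hi : (h ^+ 2)^-1 != 0 by rewrite invr_eq0 expf_neq0.
rewrite eigenvalue_preconditioned; last first.
  rewrite unitmxE unitfE /uzawa_symbol detZ mulf_neq0 ?expf_neq0 ?C0 //.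
  rewrite det_mx3 !(mul0r, mulr0, subr0, addr0) !mulf_neq0 ?C0 //.
    by rewrite mulf_neq0.
    by rewrite mulf_neq0.
  by rewrite oppr_eq0 mulf_neq0 ?expf_neq0 // invr_eq0.
set d1 := ('i%C * (2 * h * sin (theta.1 / 2))%:C%C).
set d2 := ('i%C * (2 * h * sin (theta.2 / 2))%:C%C).
(* [N] is the common diagonal entry of the two velocity rows of the pencil. *)
set N := (z - 1) * (alpha * ms)%:C%C + omega%:C%C * (4 * m)%:C%C.
have -> : (z - 1) *: uzawa_symbol h alpha sigma theta
    + omega%:C%C *: stokes_symbol h theta
  = ((h ^+ 2)^-1)%:C%C *: mx3 [:: [:: N; 0; omega%:C%C * d1];
       [:: 0; N; omega%:C%C * d2];
       [:: - (z - 1 + omega%:C%C) * d1; - (z - 1 + omega%:C%C) * d2;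
           (z - 1) * (- (sigma^-1 * h ^+ 2))%:C%C]].
  rewrite /uzawa_symbol /stokes_symbol -/d1 -/d2 -/m -/ms.
  apply/matrixP => i j; rewrite !mxE /N.
  by case: i => [[|[|[|]]]] // ?; case: j => [[|[|[|]]]] // ? /=; ring.
rewrite detZ mulf_eq0 expf_eq0 (negbTE (C0 _ hi)) andbF /= det_mx3.
have dd : d1 ^+ 2 + d2 ^+ 2 = (- 4 * h ^+ 2 * m)%:C%C.
  rewrite /d1 /d2 !exprMn sqr_i -mulrDr -!rmorphXn -rmorphD /= mulN1r -rmorphN /=.
  by congr (_%:C)%C; rewrite /m /m_sym; ring.
have NE : N = (alpha * ms)%:C%C * (z - (1 - t * omega)%:C%C).
  have -> : 1 - t * omega = 1 - 4 * m * omega / (alpha * ms).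
    by rewrite /t /laplace_ratio -/m -/ms; clearbody m ms; field; rewrite a0 ms0.
  rewrite /N; clearbody m ms.
  rewrite !(rmorphB, rmorphD, rmorphN, rmorphM, rmorphXn, fmorphV, rmorph1,
    rmorph_nat) /=.
  by field; rewrite !C0.
(* One factor [N] splits off, giving the eigenvalue [1 - t * omega]; in the cofactor the differences
   occur only as [d1 ^+ 2 + d2 ^+ 2], a multiple of [m]. *)
have -> : N * (N * ((z - 1) * (- (sigma^-1 * h ^+ 2))%:C%C)
        - omega%:C%C * d2 * (- (z - 1 + omega%:C%C) * d2))
    - 0 * (0 * ((z - 1) * (- (sigma^-1 * h ^+ 2))%:C%C)
        - omega%:C%C * d2 * (- (z - 1 + omega%:C%C) * d1))
    + omega%:C%C * d1 * (0 * (- (z - 1 + omega%:C%C) * d2)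
        - N * (- (z - 1 + omega%:C%C) * d1)) =
   N * (N * ((z - 1) * (- (sigma^-1 * h ^+ 2))%:C%C)
     + omega%:C%C * (z - 1 + omega%:C%C) * (d1 ^+ 2 + d2 ^+ 2)) by ring.
rewrite dd mulf_eq0.
have -> : N * ((z - 1) * (- (sigma^-1 * h ^+ 2))%:C%C)
     + omega%:C%C * (z - 1 + omega%:C%C) * (- 4 * h ^+ 2 * m)%:C%C
  = (- (h ^+ 2 * (alpha * ms) / sigma))%:C%C *
    (z ^+ 2 - (2 - t * (omega * (1 + sigma)))%:C%C * z
     + (1 - t * (omega * (1 + sigma) - sigma * omega ^+ 2))%:C%C).
  have -> : - 4 * h ^+ 2 * m = - (h ^+ 2 * (alpha * ms) * t).
    by rewrite /t /laplace_ratio -/m -/ms; clearbody m ms; field; rewrite a0 ms0.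
  rewrite NE; clearbody m ms t.
  rewrite !(rmorphB, rmorphD, rmorphN, rmorphM, rmorphXn, fmorphV, rmorph1,
    rmorph_nat) /=.
  by field; rewrite C0.
rewrite NE !mulf_eq0 subr_eq0.
have -> : (alpha * ms)%:C%C == 0 = false by apply/negbTE/C0; rewrite mulf_neq0.
suff -> : (- (h ^+ 2 * (alpha * ms) / sigma))%:C%C == 0 = false by [].
by apply/negbTE/C0; rewrite oppr_eq0 !mulf_neq0 // ?expf_neq0 // ?invr_eq0.
Qed.

End Symbol.

(* Spectral radius of the real quadratic X^2 - 2 b X + c: as [Num.sqrt]
   vanishes on negative numbers, it is sqrt c for nonreal roots and
   |b| + sqrt (b^2 - c) for real ones. *)
Definition quad_radius {R : realType} (b c : R) : R :=
  Num.sqrt (Num.max (b ^+ 2) c) + Num.sqrt (b ^+ 2 - c).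

(** * Moduli of the roots of a real quadratic *)

Section QuadRadius.
Variable R : realType.
Implicit Types (b c : R).

Lemma quad_radius_ge0 b c : 0 <= quad_radius b c.
Proof. by rewrite addr_ge0 ?sqrtr_ge0. Qed.

Lemma normr_le_sqrt_max b c : `|b| <= Num.sqrt (Num.max (b ^+ 2) c).
Proof. by rewrite -sqrtr_sqr ler_sqrt ?le_max ?sqr_ge0 ?lexx. Qed.

(** Real and imaginary parts. The second factor gives the dichotomy used below: a root is real or
    has real part [b]. *)
Lemma quad_rootE b c (x y : R) :
  (((x +i* y) ^+ 2 - (2 * b)%:C * (x +i* y) + c%:C == 0)%C) =
  (x ^+ 2 - y ^+ 2 - 2 * b * x + c == 0) && (y * (x - b) == 0).
Proof.
have -> : y * (x - b) == 0 = (2 * (y * (x - b)) == 0) by rewrite [RHS]mulf_eq0 pnatr_eq0.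
rewrite eq_complex expr2; simpc => /=.
by congr (_ && _); congr (_ == _); ring.
Qed.

(** A real root differs from [b] by the square root of [b ^+ 2 - c]; a root with real part [b] has
    squared modulus [c]. *)
Lemma quad_root_le b c (z : R[i]) :
  (z ^+ 2 - (2 * b)%:C * z + c%:C = 0)%C -> (`|z| <= (quad_radius b c)%:C)%C.
Proof.
case: z => x y /eqP; rewrite quad_rootE mulf_eq0 normc_def lecR /=.
move=> /andP[/eqP e] /orP[/eqP y0|/eqP xb].
  rewrite y0 expr0n addr0 sqrtr_sqr.
  have := ler_normD (x - b) b; rewrite subrK => /le_trans; apply.
  by rewrite /quad_radius addrC lerD ?normr_le_sqrt_max // -sqrtr_sqr;
     have -> : (x - b) ^+ 2 = b ^+ 2 - c by rewrite y0 in e; lra.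
rewrite -[leLHS]addr0 lerD ?sqrtr_ge0 // ler_wsqrtr // le_max.
have xE : x = b by lra.
by rewrite xE in e *; apply/orP; right; lra.
Qed.

Lemma quad_root_exists b c : exists z : R[i],
  [/\ (z ^+ 2 - (2 * b)%:C * z + c%:C = 0)%C & (`|z| = (quad_radius b c)%:C)%C].
Proof.
rewrite /quad_radius; have [cb|bc] := leP c (b ^+ 2).
  set s := Num.sqrt (b ^+ 2 - c).
  have s2 : s ^+ 2 = b ^+ 2 - c by rewrite sqr_sqrtr ?subr_ge0.
  have s0 : 0 <= s by apply: sqrtr_ge0.
  (* The sign is chosen so that [b] and [s] do not cancel. *)
  exists ((if 0 <= b then b + s else b - s)%:C)%C; split.
    apply/eqP; rewrite quad_rootE mul0r eqxx andbT.
    by apply/eqP; case: ifP => _; nra.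
  rewrite normc_def /= expr0n addr0 !sqrtr_sqr; congr (_%:C)%C.
  case: (leP 0 b) => b0; first by rewrite !ger0_norm ?addr_ge0.
  by rewrite !ltr0_norm //; lra.
rewrite [X in _ + X]ler0_sqrtr ?addr0; last by lra.
exists (b +i* Num.sqrt (c - b ^+ 2))%C; split.
  apply/eqP; rewrite quad_rootE subrr mulr0 eqxx andbT.
  by rewrite sqr_sqrtr ?subr_ge0 ?ltW //; apply/eqP; ring.
by rewrite normc_def /= sqr_sqrtr ?subr_ge0 ?ltW // addrC subrK.
Qed.

(** [c] is the product of the two roots. The proof compares squares instead: [c] is at most
    [u ^+ 2], and [- c] at most [s ^+ 2]. *)
Lemma normr_le_sqr_quad_radius b c : `|c| <= quad_radius b c ^+ 2.
Proof.
rewrite /quad_radius; set u := Num.sqrt (Num.max _ _); set s := Num.sqrt _.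
have u0 : 0 <= u by apply: sqrtr_ge0.
have s0 : 0 <= s by apply: sqrtr_ge0.
have u2 : u ^+ 2 = Num.max (b ^+ 2) c by rewrite sqr_sqrtr // le_max sqr_ge0.
have s2 : b ^+ 2 - c <= s ^+ 2.
  rewrite /s; case: (leP 0 (b ^+ 2 - c)) => [?|/ltW ?]; first by rewrite sqr_sqrtr.
  by rewrite (le_trans _ (sqr_ge0 _)).
have ub : b ^+ 2 <= u ^+ 2 by rewrite u2 le_max lexx.
have uc : c <= u ^+ 2 by rewrite u2 le_max lexx orbT.
have := sqr_ge0 b; rewrite ler_norml => ?; apply/andP; split; nra.
Qed.

(** [Num.sqrt] is continuous on the whole line, so the passage from real to nonreal roots needs no
    case split. *)
Lemma continuous_quad_radius (f g : R -> R) :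
  continuous f -> continuous g -> continuous (fun x => quad_radius (f x) (g x)).
Proof.
move=> cf cg x.
have cf2 : continuous (fun x => f x ^+ 2).
  by move=> y; apply: (cvg_comp f (fun z => z ^+ 2)); [exact: cf|exact: exprn_continuous].
apply: cvgD.
  apply: (@continuous_comp _ _ _ (fun x => Num.max (f x ^+ 2) (g x)) Num.sqrt);
    last exact: sqrt_continuous.
  exact: (continuous_max (cf2 x) (cg x)).
apply: (@continuous_comp _ _ _ (fun x => (f x ^+ 2) - (g x)) Num.sqrt);
    last exact: sqrt_continuous.
apply: cvgB; [exact: cf2|exact: cg].
Qed.

End QuadRadius.

(** * Range of the Laplace ratio on the high frequencies *)

Section Range.
Variable R : realType.

Lemma laplace_ratioE (theta : R * R) :
  laplace_ratio theta =
  (2 - cos theta.1 - cos theta.2) * (2 + cos theta.1) * (2 + cos theta.2) / 18.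
Proof.
have sin2_half (x : R) : sin (x / 2) ^+ 2 = (1 - cos x) / 2.
  have -> : cos x = cos ((x / 2) *+ 2) by congr cos; rewrite mulr2n; lra.
  by rewrite cos_mulr2n cos2sin2; field.
by rewrite /laplace_ratio /ms_sym invrK /m_sym !sin2_half; field.
Qed.

Lemma cos_le0 (x : R) : pi / 2 <= x <= 3 * pi / 2 -> cos x <= 0.
Proof.
move=> /andP[x1 x2]; have -> : x = (x - pi) + pi by rewrite subrK.
by rewrite cosDpi oppr_le0 cos_ge0_pihalf //; apply/andP; split; lra.
Qed.

Lemma laplace_ratio_bounds (a b : R) : -1 <= a <= 0 -> -1 <= b <= 1 ->
  2 / 9 <= (2 - a - b) * (2 + a) * (2 + b) / 18 <= 4 / 9.
Proof.
move=> /andP[a1 a0] /andP[b1 b2].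
(* The first two terms interpolate linearly between the values at [a = -1] and [a = 0]; the third is
   the quadratic remainder. *)
have -> : (2 - a - b) * (2 + a) * (2 + b) / 18 =
    2 / 9 + (- a * ((1 + b) * (2 - b)) + (1 + a) * (4 - 2 * b ^+ 2)
             + (2 + b) * (- a * (1 + a))) / 18 by field.
(* Lower bound: concavity in a on [-1, 0]. *)
have p1 : 0 <= - a * ((1 + b) * (2 - b)) by rewrite !mulr_ge0 //; lra.
have p2 : 0 <= (1 + a) * (4 - 2 * b ^+ 2) by rewrite mulr_ge0 //; nra.
have p3 : 0 <= (2 + b) * (- a * (1 + a)) by rewrite !mulr_ge0 //; lra.
(* Upper bound: AM-GM for three factors of sum 6. *)
have p4 : 0 <= (2 - a - b) * (a - b) ^+ 2 by rewrite mulr_ge0 ?sqr_ge0 //; lra.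
have p5 : 0 <= (a + b) ^+ 2 * (6 + a + b) by rewrite mulr_ge0 ?sqr_ge0 //; lra.
by apply/andP; split; lra.
Qed.

Lemma laplace_ratio_high (theta : R * R) :
  Thigh theta -> 2 / 9 <= laplace_ratio theta <= 4 / 9.
Proof.
case: theta => x y; rewrite /Thigh /= !in_itv /= => -[[/andP[x1 x2] /andP[y1 y2]] xy].
(* Outside the low-frequency square, some coordinate lies between [pi / 2] and [3 * pi / 2]. *)
have [cxy|cxy] : cos x <= 0 \/ cos y <= 0.
- have [?|xp] := leP (pi / 2) x; first
    by left; rewrite cos_le0 //; apply/andP; split; lra.
  have [?|yp] := leP (pi / 2) y; first
    by right; rewrite cos_le0 //; apply/andP; split; lra.
  by case: xy; rewrite x1 y1 xp yp.
- by rewrite laplace_ratioE laplace_ratio_bounds ?cos_geN1 ?cos_le1.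
- have := @laplace_ratio_bounds (cos y) (cos x).
  rewrite !cos_geN1 cos_le1 cxy laplace_ratioE /= => /(_ isT isT).
  by move=> /andP[p1 p2]; apply/andP; split; lra.
Qed.

(** On the diagonal from [pi / 2] to [pi] the ratio passes continuously from 4/9 to 2/9. *)
Lemma laplace_ratio_onto (q : R) : 2 / 9 <= q <= 4 / 9 ->
  exists2 theta, Thigh theta & laplace_ratio theta = q.
Proof.
move=> q49; have pi0 := @pi_gt0 R.
pose f (x : R) := (2 - cos x - cos x) * (2 + cos x) * (2 + cos x) / 18.
have cf : continuous f.
  move=> x; have cc : (cos y @[y --> x] --> cos x)%classic := @continuous_cos R x.
  have c2 : ((fun=> 2 : R) y @[y --> x] --> (2 : R))%classic by exact: cvg_cst.
  apply: cvgMl; apply: cvgM; last exact: cvgD.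
  by apply: cvgM; [apply: cvgB => //; apply: cvgB|apply: cvgD].
have [] := @IVT R f (pi / 2) pi q.
- by lra.
- exact: continuous_subspaceT.
- rewrite /f cos_pihalf cospi.
  have -> : (2 - 0 - 0) * (2 + 0) * (2 + 0) / 18 = 4 / 9 :> R by field.
  have -> : (2 - -1 - -1) * (2 + -1) * (2 + -1) / 18 = 2 / 9 :> R by field.
  by rewrite min_r ?max_l //; lra.
move=> x; rewrite in_itv /= => /andP[x1 x2] fx.
exists (x, x); last by rewrite laplace_ratioE.
rewrite /Thigh /= !in_itv /=; split.
  by split; apply/andP; split; lra.
by case => /andP[_]; lra.
Qed.

End Range.

Lemma is_maximum_sup (R : realType) (A : set R) (x : R) : is_maximum A x -> sup A = x.
Proof.
move=> [Ax ubA]; apply/eqP; rewrite eq_le ge_sup //; last by exists x.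
by rewrite ub_le_sup //; exists x.
Qed.

Lemma is_minimum_inf (R : realType) (A : set R) (x : R) : is_minimum A x -> inf A = x.
Proof.
move=> [Ax lbA]; apply/eqP; rewrite eq_le lb_le_inf //; last by exists x.
by rewrite ge_inf //; exists x.
Qed.

(** Spectral radius of the error symbol as a function of [t] alone. *)
Definition uzawa_radius {R : realType} (omega sigma t : R) : R :=
  Num.max `|1 - t * omega|
    (quad_radius (1 - t * (omega * (1 + sigma)) / 2)
                 (1 - t * (omega * (1 + sigma) - sigma * omega ^+ 2))).

(** * The smoothing factor as an attained maximum, and its lower bound *)

Section Radius.
Variable R : realType.
Variables h alpha omega sigma : R.
Hypotheses (h_gt0 : 0 < h) (alpha0 : alpha != 0) (sigma0 : sigma != 0).

Local Notation S := (uzawa_error_symbol h alpha omega sigma).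
Local Notation t theta := (4 * laplace_ratio theta / alpha).

Lemma uzawa_eigenvalueE theta (z : R[i]) :
  eigenvalue (S theta) z =
  (z == (1 - t theta * omega)%:C%C) ||
  (z ^+ 2 - (2 * (1 - t theta * (omega * (1 + sigma)) / 2))%:C%C * z
    + (1 - t theta * (omega * (1 + sigma) - sigma * omega ^+ 2))%:C%C == 0).
Proof.
have h0 : h != 0 by rewrite lt0r_neq0.
have -> : 2 * (1 - t theta * (omega * (1 + sigma)) / 2) =
   2 - t theta * (omega * (1 + sigma)) by field.
exact: eigenvalue_uzawa.
Qed.

Lemma uzawa_eigenvalue_le theta (z : R[i]) :
  eigenvalue (S theta) z -> `|z| <= (uzawa_radius omega sigma (t theta))%:C%C.
Proof.
rewrite uzawa_eigenvalueE => /orP[/eqP ->|/eqP /quad_root_le].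
  by rewrite normc_def /= expr0n addr0 sqrtr_sqr lecR le_max lexx.
by move=> /le_trans; apply; rewrite lecR le_max lexx orbT.
Qed.

Lemma uzawa_eigenvalue_exists theta : exists2 z : R[i],
  eigenvalue (S theta) z & `|z| = (uzawa_radius omega sigma (t theta))%:C%C.
Proof.
rewrite /uzawa_radius; case: leP => _.
  have [z [z0 zr]] := quad_root_exists R (1 - t theta * (omega * (1 + sigma)) / 2)
    (1 - t theta * (omega * (1 + sigma) - sigma * omega ^+ 2)).
  by exists z => //; rewrite uzawa_eigenvalueE z0 eqxx orbT.
exists (1 - t theta * omega)%:C%C; first by rewrite uzawa_eigenvalueE eqxx.
by rewrite normc_def /= expr0n addr0 sqrtr_sqr.
Qed.

Lemma continuous_uzawa_radius :
  continuous (fun q : R => uzawa_radius omega sigma (4 * q / alpha)).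
Proof.
have caff (k : R) : continuous (fun q : R => 1 - 4 * q / alpha * k).
  move=> x; apply: cvgB; first exact: cvg_cst.
  by apply: cvgMl; apply: cvgMl; apply: cvgMr; exact: cvg_id.
move=> x; rewrite /uzawa_radius.
have c1 : {for x, continuous (fun q : R => `|1 - 4 * q / alpha * omega| : R^o)}.
  by apply: cvg_norm; exact: caff.
have c2 : {for x, continuous (fun q : R =>
    quad_radius (1 - 4 * q / alpha * (omega * (1 + sigma)) / 2)
      (1 - 4 * q / alpha * (omega * (1 + sigma) - sigma * omega ^+ 2)) : R^o)}.
  apply: continuous_quad_radius => y; last exact: caff.
  under eq_fun do rewrite -mulrA.
  exact: caff.
exact: (continuous_max c1 c2).
Qed.

(** [Thigh] is not compact, so the extreme value theorem is applied on the closed range of the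
    ratio; surjectivity turns the maximizer back into a frequency. *)
Lemma high_freq_moduli_max : exists q : R,
  [/\ 2 / 9 <= q <= 4 / 9,
      is_maximum (high_freq_moduli h alpha omega sigma)
                 (uzawa_radius omega sigma (4 * q / alpha))
    & forall q', 2 / 9 <= q' <= 4 / 9 ->
        uzawa_radius omega sigma (4 * q' / alpha) <=
        uzawa_radius omega sigma (4 * q / alpha)].
Proof.
have [||q qI qmax] := @EVT_max R
  (fun q => uzawa_radius omega sigma (4 * q / alpha)) (2 / 9) (4 / 9).
- by lra.
- exact/continuous_subspaceT/continuous_uzawa_radius.
exists q; split => //.
have [theta Ttheta qE] := laplace_ratio_onto _ q qI.
split.
  have [z Sz zE] := uzawa_eigenvalue_exists theta.
  by exists theta, z; split => //; rewrite zE qE.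
move=> r [theta' [z [Tt Sz zr]]].
rewrite -lecR -zr; apply: (le_trans (uzawa_eigenvalue_le _ _ Sz)).
by rewrite lecR qmax //; exact: laplace_ratio_high.
Qed.

Lemma smoothing_factor_max :
  is_maximum (high_freq_moduli h alpha omega sigma)
             (smoothing_factor h alpha omega sigma).
Proof.
have [q [_ qmax _]] := high_freq_moduli_max.
by rewrite /smoothing_factor (is_maximum_sup _ _ _ qmax).
Qed.

Lemma uzawa_radius_le_smoothing_factor (q : R) : 2 / 9 <= q <= 4 / 9 ->
  uzawa_radius omega sigma (4 * q / alpha) <= smoothing_factor h alpha omega sigma.
Proof.
move=> qI; have [q' [_ qmax]] := high_freq_moduli_max.
by rewrite /smoothing_factor (is_maximum_sup _ _ _ qmax); apply.
Qed.

Lemma smoothing_factor_le (r : R) :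
  (forall q, 2 / 9 <= q <= 4 / 9 -> uzawa_radius omega sigma (4 * q / alpha) <= r) ->
  smoothing_factor h alpha omega sigma <= r.
Proof.
move=> le_r; have [q [qI qmax _]] := high_freq_moduli_max.
by rewrite /smoothing_factor (is_maximum_sup _ _ _ qmax) le_r.
Qed.

Lemma smoothing_factor_ge : Num.sqrt (1 / 3) <= smoothing_factor h alpha omega sigma.
Proof.
set r := smoothing_factor _ _ _ _.
have prod_le q : 2 / 9 <= q <= 4 / 9 ->
    `|1 - 4 * q / alpha * (omega * (1 + sigma) - sigma * omega ^+ 2)| <= r ^+ 2.
  move=> /uzawa_radius_le_smoothing_factor; rewrite ge_max => /andP[_ le_r].
  set b := _ - _ / 2 in le_r; apply: le_trans (normr_le_sqr_quad_radius R b _) _.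
  apply: lerXn2r => //; rewrite nnegrE ?quad_radius_ge0 //.
  exact: le_trans (quad_radius_ge0 _ _ _) le_r.
have r0 : 0 <= r.
  apply: (@le_trans _ _ (uzawa_radius omega sigma (4 * (2 / 9) / alpha))).
    by rewrite le_max normr_ge0.
  by apply: uzawa_radius_le_smoothing_factor; lra.
rewrite -(ger0_norm r0) -sqrtr_sqr ler_wsqrtr //.
have := prod_le (2 / 9); have := prod_le (4 / 9).
(* [x] and [2 * x] are the values of t D at the two ends of the range. *)
set x := 4 * (2 / 9) / alpha * (omega * (1 + sigma) - sigma * omega ^+ 2).
have -> : 4 * (4 / 9) / alpha * (omega * (1 + sigma) - sigma * omega ^+ 2) = 2 * x.
  by rewrite /x; field.
rewrite !ler_norml => p2 p1.
have /andP[h1 h2] : - r ^+ 2 <= 1 - 2 * x <= r ^+ 2 by apply: p2; lra.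
have /andP[h3 h4] : - r ^+ 2 <= 1 - x <= r ^+ 2 by apply: p1; lra.
lra.
Qed.

End Radius.

(** * Optimality of the stated parameters *)

Section Optimum.
Variable R : realType.
Local Notation mu := (Num.sqrt (1 / 3) : R).

Lemma mu_sqr : mu ^+ 2 = 1 / 3.
Proof. by rewrite sqr_sqrtr. Qed.

Lemma mu_bounds : 1 / 2 < mu < 2 / 3.
Proof.
have mu0 : 0 <= mu by apply: sqrtr_ge0.
by have := mu_sqr => mu2; apply/andP; split; nra.
Qed.

(* The quadratic is affine in s, with values z^2 - z + 1/3 > 0 and
   z^2 - 1/3 at s = 1 and s = 2: it has no real root beyond mu. *)
Lemma quad_root_le_mu (s : R) (z : R[i]) : 1 <= s <= 2 ->
  (z ^+ 2 - (2 * (1 - s / 2))%:C * z + (1 - s * (2 / 3))%:C = 0)%C ->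
  (`|z| <= mu%:C)%C.
Proof.
case: z => x y /andP[s1 s2] /eqP; rewrite quad_rootE mulf_eq0 normc_def lecR /=.
move=> /andP[/eqP e] yx; apply: ler_wsqrtr.
case/orP: yx => /eqP yx; last first.
  have xE : x = 1 - s / 2 by lra.
  by rewrite xE in e *; lra.
rewrite yx expr0n /= in e *.
rewrite leNgt; apply/negP => xgt.
have p1 : 0 <= (2 - s) * (x ^+ 2 - x + 1 / 3).
  have := sqr_ge0 (x - 1 / 2) => ?; rewrite mulr_ge0 //; nra.
have p2 : 0 <= (s - 1) * (x ^+ 2 - 1 / 3) by rewrite mulr_ge0 //; lra.
(* The weights [2 - s] and [s - 1] cannot both vanish; splitting at 3/2 picks one that is positive
   and makes the inequality strict. *)
have [s_1|s_1] := leP s (3 / 2).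
  have p3 : 0 < (2 - s) * (x ^+ 2 - x + 1 / 3).
    have := sqr_ge0 (x - 1 / 2) => ?; rewrite mulr_gt0 //; nra.
  nra.
have p3 : 0 < (s - 1) * (x ^+ 2 - 1 / 3) by rewrite mulr_gt0 //; lra.
nra.
Qed.

Lemma quad_radius_le_mu (s : R) : 1 <= s <= 2 ->
  quad_radius (1 - s / 2) (1 - s * (2 / 3)) <= mu.
Proof.
move=> sI; have [z [z0 zr]] := quad_root_exists R (1 - s / 2) (1 - s * (2 / 3)).
by rewrite -lecR -zr; exact: quad_root_le_mu z0.
Qed.

Variables h alpha omega sigma : R.
Hypothesis h_gt0 : 0 < h.
Hypothesis omegaI : 1 / (3 * mu) <= omega <= 2 / (3 * (1 - mu)).
Hypothesis alphaE : alpha = 8 * omega ^+ 2 / (3 * (3 * omega - 1)).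
Hypothesis sigmaE : sigma = 1 / (3 * omega - 1).

(** The range of [omega] is restated for its inverse, in which the eigenvalue [1 - t * omega] is
    affine once [alpha] is substituted. *)
Lemma omega_bounds :
  [/\ 0 < omega, 0 < 3 * omega - 1, omega^-1 <= 3 * mu & 3 * (1 - mu) <= 2 * omega^-1].
Proof.
have /andP[mu1 mu2] := mu_bounds; case/andP: omegaI => w1 o2.
have w1' : 1 <= omega * (3 * mu) by rewrite -ler_pdivrMr //; lra.
have o2' : omega * (3 * (1 - mu)) <= 2 by rewrite -ler_pdivlMr //; lra.
have w0 : 0 < omega by nra.
split => //.
- by nra.
- by rewrite -[leLHS]mul1r ler_pdivrMr // mulrC.
- by rewrite ler_pdivlMr // mulrC.
Qed.

Lemma parameters_neq0 : alpha != 0 /\ sigma != 0.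
Proof.
have [w0 w1 _ _] := omega_bounds; rewrite alphaE sigmaE.
by split; rewrite lt0r_neq0 // ?divr_gt0 ?mulr_gt0 ?exprn_gt0 //; lra.
Qed.

Lemma m2_eq_m_opt : 4 * alpha * sigma / (1 + sigma) ^+ 2 = m_opt R.
Proof.
have [w0 w1 _ _] := omega_bounds; rewrite alphaE sigmaE /m_opt; field.
by apply/andP; split; apply: lt0r_neq0; lra.
Qed.

Lemma uzawa_radius_le_mu (q : R) : 2 / 9 <= q <= 4 / 9 ->
  uzawa_radius omega sigma (4 * q / alpha) <= mu.
Proof.
move=> /andP[q1 q2]; have [w0 w1 o2 o3] := omega_bounds.
have o4 : 3 * omega - 1 != 0 by apply: lt0r_neq0.
have omega0 : omega != 0 by apply: lt0r_neq0.
(* Normalized so that t A becomes [s] and t D becomes [s * (2 / 3)]. *)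
pose s := 9 / 2 * q; have sI : 1 <= s <= 2 by rewrite /s; apply/andP; split; lra.
rewrite ge_max; apply/andP; split.
  have -> : 4 * q / alpha * omega = s * (1 - omega^-1 / 3).
    by rewrite alphaE /s; field; rewrite ?omega0 ?o4.
  have /andP[mu1 mu2] := mu_bounds; case/andP: sI => s1 s2.
  have v0 : 0 < omega^-1 by rewrite invr_gt0.
  (* The eigenvalue decreases in [s]: the end [s = 1] uses the upper bound on the inverse of
     [omega], the end [s = 2] the lower one. *)
  by rewrite ler_norml; apply/andP; split; nra.
have -> : 4 * q / alpha * (omega * (1 + sigma)) = s.
  by rewrite alphaE sigmaE /s; field; rewrite ?omega0 ?o4.
have -> : 4 * q / alpha * (omega * (1 + sigma) - sigma * omega ^+ 2) = s * (2 / 3).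
  by rewrite alphaE sigmaE /s; field; rewrite ?omega0 ?o4.
exact: quad_radius_le_mu.
Qed.

Lemma smoothing_factor_optimal : smoothing_factor h alpha omega sigma = mu.
Proof.
have [a0 s0] := parameters_neq0.
apply/eqP; rewrite eq_le smoothing_factor_ge // andbT.
by apply: smoothing_factor_le => // q; exact: uzawa_radius_le_mu.
Qed.

End Optimum.

(** * The minimum over all parameters *)

Lemma mu_opt_minimum (R : realType) (h : R) : 0 < h ->
  is_minimum (smoothing_factors h) (Num.sqrt (1 / 3)).
Proof.
move=> h_gt0; split.
  have /andP[mu1 mu2] := mu_bounds R.
  (* [omega = 1] is an admissible witness; the formulas then give [alpha] = 4/3 and [sigma] =
     1/2. *)
  have oI : 1 / (3 * Num.sqrt (1 / 3)) <= (1 : R) <= 2 / (3 * (1 - Num.sqrt (1 / 3))).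
    by rewrite ler_pdivrMr ?ler_pdivlMr; [apply/andP; split|..]; lra.
  have [a0 s0] := parameters_neq0 _ _ _ _ oI erefl erefl.
  eexists _, _, _; split; [exact: a0|exact: s0|].
  exact/esym/(smoothing_factor_optimal _ _ _ _ _ h_gt0 oI erefl erefl).
by move=> _ [alpha [omega [sigma [a0 s0 ->]]]]; exact: smoothing_factor_ge.
Qed.

Theorem theorem3p6 (R : realType) (h : R) (h_gt0 : 0 < h) :
  [/\ (forall alpha omega sigma : R, alpha != 0 -> sigma != 0 ->
         is_maximum (high_freq_moduli h alpha omega sigma)
                    (smoothing_factor h alpha omega sigma)),
      is_minimum (smoothing_factors h) (mu_opt h),
      mu_opt h = Num.sqrt (1 - 9 * m_opt R / 16),
      Num.sqrt (1 - 9 * m_opt R / 16) = Num.sqrt (1 / 3) :> R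
    & forall alpha omega sigma : R,
        1 / (3 * mu_opt h) <= omega <= 2 / (3 * (1 - mu_opt h)) ->
        alpha = 8 * omega ^+ 2 / (3 * (3 * omega - 1)) ->
        sigma = 1 / (3 * omega - 1) ->
        [/\ alpha != 0,
            sigma != 0,
            4 * alpha * sigma / (1 + sigma) ^+ 2 = m_opt R
          & smoothing_factor h alpha omega sigma = mu_opt h]].
Proof.
have mu_min := mu_opt_minimum R h h_gt0.
have muE : mu_opt h = Num.sqrt (1 / 3) by exact: is_minimum_inf.
have m13 : 1 - 9 * m_opt R / 16 = 1 / 3 by rewrite /m_opt; field.
rewrite muE m13; split => //.
- by move=> alpha omega sigma a0 s0; exact: smoothing_factor_max.
move=> alpha omega sigma oI aE sE.
have [a0 s0] := parameters_neq0 _ _ _ _ oI aE sE.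
split => //; first exact: m2_eq_m_opt oI aE sE.
exact: smoothing_factor_optimal.
Qed.
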